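(* Let $d\ge 2$, $b\ge 3$ be integers, $A\subseteq[0,b-1]\cap\mathbb{Z}$, and $0\le m\le d$ an integer. Let $$N=\sum_{i=0}^{m-1}\binom{d-1}{i}|A|^i(b-|A|)^{d-i-1}$$ (with the convention $0^0=1$), assume $N\ge 1$, and let $E=\frac{\log(N)}{\log(N)+\log(b)}$. Then $$sep_{S(d,b,A,m)}(n)\preceq n^E.$$ Moreover, for $m=1$, $$sep_{S(d,b,A,1)}(n)\asymp n^E,\qquad\text{with } E=\frac{(d-1)\log(b-|A|)}{(d-1)\log(b-|A|)+\log(b)}.$$
   Context: For each $k\ge 0$, $\Gamma_k(d,b,A,m)$ is the graph with vertex set $$V_k=\{(x_1,\dots,x_d)\in\mathbb{Z}^d\cap[0,b^k)^d : |\{i : x_{i,j}\in A\}|\le m \text{ for all } 0\le j\le k-1\},$$ where $x_i=\sum_{j=0}^{k-1}x_{i,j}b^j$ with $x_{i,j}\in\{0,\dots,b-1\}$ is the base-$b$ expansion of $x_i$ (with $k$ digits), and with edges joining two vertices whenever their $\ell^1$-distance in $\mathbb{Z}^d$ is $1$. The infinite graph $S(d,b,A,m)$ is the union $\bigcup_{k=0}^{\infty}\Gamma_k(d,b,A,m)$. For a finite graph $G$, $|G|$ is its number of vertices, $L(G)$ is a largest connected component of $G$, and for $\epsilon\in(0,1)$, $cut^{\epsilon}(G)=\min\{|T| : T\subseteq V(G),\ |L(G-T)|\le\epsilon|G|\}$, where $G-T$ is the graph obtained by deleting the vertices in $T$. For an infinite graph $X$, $sep^{\epsilon}_X(n)=\sup\{cut^{\epsilon}(G)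 : G\le X \text{ a finite subgraph},\ |G|\le n\}$. We write $sep_X=sep_X^{1/2}$ (up to $\asymp$ the choice of $\epsilon\in(0,1)$ does not matter). For functions $f,g$ of $n\in\mathbb{Z}_{\ge 1}$, $f\preceq g$ means $f(n)=\mathcal{O}(g(n))$ (the constant may depend on $d,b,A,m$), and $f\asymp g$ means $f\preceq g$ and $g\preceq f$. *)

(* Defs.v *)
From HB Require Import structures.
From mathcomp Require Import all_boot all_order all_algebra.
From mathcomp Require Import finmap.
From mathcomp Require Import all_classical all_reals all_analysis.
Import numFieldNormedType.Exports.
Set Implicit Arguments.
Unset Strict Implicit.
Unset Printing Implicit Defensive.
Import Order.TTheory GRing.Theory Num.Theory.
Local Open Scope ring_scope.

Record graph (T : Type) := Graph {
  vertex : set T;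
  edge : T -> T -> Prop;
  edge_sym : forall x y, edge x y -> edge y x;
  edge_irr : forall x, ~ edge x x;
  edge_vertex : forall x y, edge x y -> vertex x }.

Section GraphUnion.
Context {T : Type} (G : nat -> graph T).

Definition union_vertex : set T := (\bigcup_k vertex (G k))%classic.
Definition union_edge (x y : T) := exists k, edge (G k) x y.

Lemma union_edge_sym x y : union_edge x y -> union_edge y x.
Proof. by move=> [k xy]; exists k; exact: edge_sym. Qed.

Lemma union_edge_irr x : ~ union_edge x x.
Proof. by move=> [k]; exact: edge_irr. Qed.

Lemma union_edge_vertex x y : union_edge x y -> union_vertex x.
Proof. by move=> [k xy]; exists k => //; exact: edge_vertex xy. Qed.

(* Two vertices are adjacent in the union only if they are adjacent in one of
   the [G k]; the union need not be an induced subgraph of the lattice. *)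
Definition graph_union : graph T :=
  Graph union_edge_sym union_edge_irr union_edge_vertex.

End GraphUnion.

Section FiniteCut.
Context {V : finType} (e : rel V).
Implicit Type S : {set V}.

Definition del_edge S : rel V :=
  [rel x y | [&& x \notin S, y \notin S & e x y]].

Definition component S (x : V) : {set V} :=
  [set y | connect (del_edge S) x y].

(* The order of a largest connected component of [(V, e) - S], and [0] if
   [S] is all of [V]. *)
Definition max_component S : nat :=
  (\max_(x | x \notin S) #|component S x|)%N.

Lemma max_componentT : max_component [set: V] = 0%N.
Proof. by rewrite /max_component big_pred0 // => x; rewrite inE. Qed.

Context {R : realType} (eps : R).

Definition is_cutset S : bool :=
  (max_component S)%:R <= eps * #|V|%:R.

(* For [0 <= eps] the default [setT] is a cut set by [is_cutset_setT], so
   this is the minimum over all cut sets. *)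
Definition vertex_cut : nat := #|[arg min_(S < [set: V] | is_cutset S) #|S|]|.

Lemma is_cutset_setT : 0 <= eps -> is_cutset [set: V].
Proof. by move=> e0; rewrite /is_cutset max_componentT mulr_ge0. Qed.

Lemma vertex_cut_le_card : (vertex_cut <= #|V|)%N.
Proof. exact: max_card. Qed.

End FiniteCut.

Section Separation.
Context {R : realType} {T : choiceType}.
Local Open Scope fset_scope.

(* A finite subgraph is a finite set [W] of vertices of [X] with any symmetric
   set [e] of edges of [X] between elements of [W]; it need not be induced. *)
Definition finite_subgraph (X : graph T) (W : {fset T}) (e : rel W) : Prop :=
  [/\ symmetric e,
      forall x : W, vertex X (val x) &
      forall x y : W, e x y -> edge X (val x) (val y)].

Definition cut_values (eps : R) (X : graph T) (n : nat) : set R :=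
  [set c | exists (W : {fset T}) (e : rel W),
     [/\ finite_subgraph X e, (#|` W| <= n)%N & c = (vertex_cut e eps)%:R]]%classic.

Definition sep (eps : R) (X : graph T) (n : nat) : R :=
  sup (cut_values eps X n).

(* The real supremum [sup] is only meaningful on nonempty bounded sets. *)
Lemma has_sup_cut_values eps X n : has_sup (cut_values eps X n).
Proof.
split.
  exists (vertex_cut (fun _ _ : (fset0 : {fset T}) => false) eps)%:R.
  exists fset0, (fun _ _ => false); split => //.
  by split => // -[x xW]; exfalso; move: xW; rewrite inE.
exists n%:R; move=> _ [W [e [_ Wn ->]]].
by rewrite ler_nat (leq_trans (vertex_cut_le_card _ _))// -cardfE.
Qed.

End Separation.

Definition digit (b x j : nat) : nat := (x %/ b ^ j %% b)%N.

Lemma digit_lt b x j : (0 < b)%N -> (digit b x j < b)%N.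
Proof. exact: ltn_pmod. Qed.

Lemma digit_expansion b k x : (x < b ^ k)%N ->
  x = (\sum_(j < k) digit b x j * b ^ j)%N.
Proof.
elim: k x => [|k IH] x xk; first by rewrite big_ord0; case: x xk.
have b0 : (0 < b)%N by move: xk; rewrite lt0n; apply: contraTneq => ->; rewrite exp0n.
rewrite big_ord_recl /= {1}/digit expn0 divn1 muln1 {1}(divn_eq x b) addnC.
congr addn; rewrite {1}(IH (x %/ b)%N) ?ltn_divLR -?expnSr // big_distrl /=.
by apply: eq_bigr => i _; rewrite /digit -divnMA -expnS -mulnA -expnSr.
Qed.

(* Points of Z^d with nonnegative coordinates. *)
Notation lattice_point d := {ffun 'I_d -> nat}.

Definition l1dist d (x y : lattice_point d) : nat :=
  (\sum_i `|(x i)%:Z - (y i)%:Z|)%N.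

Section Sponge.
Context (d b : nat) (A : {set 'I_b}) (m : nat).

Definition digit_in (x : lattice_point d) (j : nat) : {set 'I_d} :=
  [set i | [exists a in A, digit b (x i) j == a :> nat]].

Definition Gamma_vertex (k : nat) : set (lattice_point d) :=
  [set x : lattice_point d | (forall i, (x i < b ^ k)%N) /\
           (forall j, (j < k)%N -> (#|digit_in x j| <= m)%N)]%classic.

Definition Gamma_edge k (x y : lattice_point d) :=
  [/\ Gamma_vertex k x, Gamma_vertex k y & l1dist x y = 1%N].

Lemma Gamma_edge_sym k x y : Gamma_edge k x y -> Gamma_edge k y x.
Proof.
move=> [xk yk xy]; split => //; rewrite -xy /l1dist.
by apply: eq_bigr => i _; rewrite distnC.
Qed.

Lemma Gamma_edge_irr k x : ~ Gamma_edge k x x.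
Proof. by move=> [_ _]; rewrite /l1dist big1 // => i _; rewrite distnn. Qed.

Lemma Gamma_edge_vertex k x y : Gamma_edge k x y -> Gamma_vertex k x.
Proof. by case. Qed.

Definition Gamma (k : nat) : graph (lattice_point d) :=
  Graph (@Gamma_edge_sym k) (@Gamma_edge_irr k) (@Gamma_edge_vertex k).

Definition sponge : graph (lattice_point d) := graph_union Gamma.

(* In [nat], [0 ^ 0 = 1]; the subtractions are exact when [m <= d]. *)
Definition Nsum : nat :=
  (\sum_(i < m) 'C(d.-1, i) * #|A| ^ i * (b - #|A|) ^ (d - i - 1))%N.

End Sponge.

Definition growth_exponent {R : realType} (b N : nat) : R :=
  ln N%:R / (ln N%:R + ln b%:R).

Definition preceq {R : realType} (f g : nat -> R) : Prop :=
  ((f : nat -> R^o) =O_\oo (g : nat -> R^o))%classic.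

Definition asymp {R : realType} (f g : nat -> R) : Prop :=
  preceq f g /\ preceq g f.

(* Main.v *)
(* Upper bound.  Take a subgraph with at most [n] vertices and [i] such that
   [(N b)^i <= n < (N b)^(i+1)], so that [N^i <= n^E].  Fix a digit [a],
   chosen in [A] when [A] is nonempty.  A hyperplane on which the last [j]
   digits of the fixed coordinate all equal [a] meets a cube of side [b^j] in
   [O(N^j)] vertices, since at each of these digits at most [m - 1] of the
   other coordinates may have a digit in [A].  These hyperplanes divide space
   into cells of side [b^j].  If for some [j < i] a cell of level [j + 1] holds
   more than half of the vertices but no cell of level [j] does, removing the
   hyperplanes of level [j] in and around that cell costs [O(N^j)].  Otherwise
   no cell of level [i] holds more than half of the vertices.  By pigeonhole,
   removing in each direction a suitable residue class of hyperplanes modulo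
   [b^i] costs at most [n / b^i = O(N^i)] and leaves boxes of side [b^i]; a box
   holding more than half of the vertices is then cut by the hyperplanes of
   level [i], at cost [O(N^i)].

   Lower bound for [m = 1].  Let [C] be the set of [k]-digit numbers without
   digits in [A] and [Q = #|C|], so that [Q^(d-1) = N^k].  The points with all
   but one coordinate in [C] form a [d]-dimensional grid of lines of length
   [b^k], with at most [d (N b)^k] vertices.  Given a set [S] of removed
   vertices, join points of [C^d] by changing the coordinates one at a time.
   As each line is used by [Q^(d+1)] of the [Q^(2d)] pairs, some point of [C^d]
   reaches all but [d #|S| Q] others, and the lines that it does not reach
   have at most [2 d^2 #|S| b^k] vertices.  So [4 d^2 #|S| >= Q^(d-1)] is needed
   to leave no component with more than half of the vertices. *)

Require Import Defs.
From mathcomp Require Import all_boot all_order all_algebra.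
From mathcomp Require Import finmap.
From mathcomp Require Import all_classical all_reals all_analysis.
From mathcomp Require Import zify.
Import Order.TTheory GRing.Theory Num.Theory.
Set Implicit Arguments.
Unset Strict Implicit.
Unset Printing Implicit Defensive.
Local Open Scope ring_scope.

(** * Bounding components by labellings *)

Section CutLabels.
Local Open Scope nat_scope.
Context {V : finType} (e : rel V).
Implicit Type S : {set V}.

Lemma component_invariant S (T : Type) (f : V -> T) x y :
  (forall u v, u \notin S -> v \notin S -> e u v -> f u = f v) ->
  x \notin S -> y \in component e S x -> y \notin S /\ f y = f x.
Proof.
move=> fE xS; rewrite inE => /connectP[p + ->].
elim: p x xS => [|z p IH] x xS //= /andP[/and3P[_ zS xz] zp].
by have [? ->] := IH _ zS zp; rewrite (fE x z).
Qed.

(** A component cannot leave a class of a label that is constant along the surviving edges. *)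
Lemma max_component_le S (T : eqType) (f : V -> T) c :
  (forall u v, u \notin S -> v \notin S -> e u v -> f u = f v) ->
  (forall x, x \notin S -> #|[set y | (y \notin S) && (f y == f x)]| <= c) ->
  max_component e S <= c.
Proof.
move=> fE fc; apply/bigmax_leqP => x xS; apply: leq_trans (fc x xS).
apply/subset_leq_card/fintype.subsetP => y /(component_invariant fE xS)[yS fyx].
by rewrite inE yS fyx eqxx.
Qed.

End CutLabels.

Section Lattice.
Local Open Scope nat_scope.

Lemma l1dist_eq1P d (x y : lattice_point d) : l1dist x y = 1 ->
  exists k, (forall l, l != k -> x l = y l) /\ (y k = (x k).+1 \/ x k = (y k).+1).
Proof.
move=> /eqP/sum_nat_eq1[k [_ xyk xyl]]; exists k; split=> [l /xyl|]; last by lia.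
by move=> /(_ isT); lia.
Qed.

Lemma l1dist1 d (x y : lattice_point d) k :
  (forall l, l != k -> x l = y l) -> y k = (x k).+1 -> l1dist x y = 1.
Proof.
move=> xyl xyk; apply/eqP/sum_nat_eq1; exists k; split=> //; first by lia.
by move=> l /xyl-> _; lia.
Qed.

End Lattice.

(** * Base-[b] digits, walls and cells *)

Section Digits.
Local Open Scope nat_scope.

Lemma digit0 b x : digit b x 0 = x %% b.
Proof. by rewrite /digit expn0 divn1. Qed.

Lemma digitS b x l : digit b x l.+1 = digit b (x %/ b) l.
Proof. by rewrite /digit expnS divnMA. Qed.

Lemma digit_out b x k l : 0 < b -> x < b ^ k -> k <= l -> digit b x l = 0.
Proof.
move=> b0 xk kl; rewrite /digit divn_small ?mod0n//.
by rewrite (leq_trans xk)// leq_pexp2l.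
Qed.

Lemma modn_expS b x k : x %% b ^ k.+1 = x %/ b %% b ^ k * b + x %% b.
Proof.
rewrite modn_divl -expnSr {1}(divn_eq (x %% b ^ k.+1) b); congr (_ + _).
by rewrite modn_dvdm// expnS dvdn_mulr.
Qed.

Fixpoint repdigit b a j := if j is j'.+1 then repdigit b a j' * b + a else 0.

Lemma repdigit_lt b a j : a < b -> repdigit b a j < b ^ j.
Proof.
move=> ab; elim: j => [|j IH] //=.
by rewrite expnSr; have := leq_mul2r b (repdigit b a j).+1 (b ^ j); rewrite IH orbT; lia.
Qed.

Lemma digit_repdigit b a j x l : a < b ->
  x = repdigit b a j %[mod b ^ j] -> l < j -> digit b x l = a.
Proof.
move=> ab; elim: j x l => [|j IH] x l //.
have b0 : 0 < b by lia.
rewrite !modn_expS /= => xE; have xb : x %% b = a.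
  have := congr1 (modn^~ b) xE.
  by rewrite /= !modnMDl !modn_mod (modn_small ab).
case: l => [_|l lj]; first by rewrite digit0.
rewrite digitS; apply: IH => //.
move: xE; rewrite xb divnMDl// (divn_small ab) addn0 modnMDl (modn_small ab).
by move/eqP; rewrite eqn_add2r eqn_pmul2r// => /eqP.
Qed.

(* The hyperplanes [x k = c] used for cutting at scale [j] are those for which
   the last [j] digits of [c] are all [a]. *)
Definition wall b a j x := [forall l : 'I_j, digit b x l == a].

Lemma wall_mod b a j x : a < b -> x = repdigit b a j %[mod b ^ j] -> wall b a j x.
Proof. by move=> ab xr; apply/forallP => l; apply/eqP/(digit_repdigit ab xr). Qed.

Lemma wallS b a j x : wall b a j.+1 x -> wall b a j x.
Proof.
by move=> /forallP w; apply/forallP => l; exact: w (widen_ord (leqnSn j) l).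
Qed.

(* The index of the interval of length [B] containing [x], the endpoints of
   the intervals being the numbers congruent to [r] modulo [B]. *)
Definition cell B r x := (x + (B - r)) %/ B.

(** The index increases exactly when [B] divides [x.+1 + (B - r)]. So an edge between two cells has
    its upper end on a boundary hyperplane. *)
Lemma cell_next B r x : r < B -> cell B r x != cell B r x.+1 ->
  cell B r x.+1 = (cell B r x).+1 /\ x.+1 = r %[mod B].
Proof.
move=> rB; have B0 : 0 < B by lia.
rewrite /cell addSn divnS//.
have [dv _|] := boolP (_ %| _); last by rewrite add0n eqxx.
split=> //; apply/eqP; rewrite -(eqn_modDr (B - r)) subnKC ?(ltnW rB)//.
by rewrite modnn -addSn in dv *.
Qed.

(** Near the origin, truncated subtraction makes the lower bound [0] and only enlarges the upper
    one. *)
Lemma cell_bounds B r x t q : 0 < B -> t <= cell B r x < t + q ->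
  t * B - (B - r) <= x < t * B - (B - r) + q * B.
Proof.
move=> B0; rewrite /cell leq_divRL// ltn_divLR// mulnDl => /andP[l1 l2].
by rewrite leq_subLR addnC l1 /=; lia.
Qed.

End Digits.

(** * Upper bound *)

Section DigitPoints.
Local Open Scope nat_scope.
Context {d b : nat} (b0 : 0 < b).

Definition digit_vector (x : lattice_point d) (l : nat) : {ffun 'I_d -> 'I_b} :=
  [ffun i => Ordinal (digit_lt (x i) l b0)].

Fixpoint digit_points (P : seq {ffun 'I_d -> 'I_b}) k : seq (lattice_point d) :=
  if k is k'.+1 then
    [seq [ffun i => x i * b + p i] | x : lattice_point d <- digit_points P k',
                                     p : {ffun 'I_d -> 'I_b} <- P]
  else [:: [ffun=> 0]].

Lemma size_digit_points P k : size (digit_points P k) = size P ^ k.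
Proof. by elim: k => [|k IH] //=; rewrite size_allpairs IH expnSr. Qed.

Lemma mem_digit_points P k x : (forall l, l < k -> digit_vector x l \in P) ->
  [ffun i => x i %% b ^ k] \in digit_points P k.
Proof.
elim: k x => [|k IH] x xP /=.
  by rewrite inE; apply/eqP/ffunP => i; rewrite !ffunE modn1.
apply/allpairsP; exists ([ffun i => [ffun i => x i %/ b] i %% b ^ k], digit_vector x 0).
split=> /=; first 1 last.
- exact: xP.
- by apply/ffunP => i; rewrite !ffunE modn_expS /= digit0.
apply: IH => l lk; rewrite (_ : digit_vector _ _ = digit_vector x l.+1) ?xP//.
by apply/ffunP => i; rewrite !ffunE; apply/val_inj; rewrite /= digitS.
Qed.

(** Meant for the lower bound, with [D] the complement of [A]; there the exact count matters, so
    repetitions have to be excluded. *)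
Fixpoint numbers_with_digits (D : seq 'I_b) k : seq nat :=
  if k is k'.+1 then [seq x * b + val a | x <- numbers_with_digits D k', a <- D] else [:: 0].

Lemma size_numbers_with_digits D k : size (numbers_with_digits D k) = size D ^ k.
Proof. by elim: k => [|k IH] //=; rewrite size_allpairs IH expnSr. Qed.

Lemma uniq_numbers_with_digits D k : uniq D -> uniq (numbers_with_digits D k).
Proof.
move=> uD; elim: k => [|k IH] //=; apply: allpairs_uniq => //.
move=> [x a] [y c] _ _ /= xy; have ay : val a = val c.
  by have := congr1 (modn^~ b) xy; rewrite /= !modnMDl !modn_small.
congr (_, _); last exact: val_inj.
by move: xy => /=; rewrite ay => /eqP; rewrite eqn_add2r eqn_pmul2r// => /eqP.
Qed.

Lemma numbers_with_digitsP D k x : x \in numbers_with_digits D k ->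
  x < b ^ k /\ forall l, l < k -> Ordinal (digit_lt x l b0) \in D.
Proof.
elim: k x => [|k IH] x /=; first by rewrite inE => /eqP->.
move=> /allpairsP[[y a] [/= /IH[yk yD] aD ->]]; have ab := ltn_ord a; split.
  by rewrite expnSr; have := leq_mul2r b y.+1 (b ^ k); rewrite yk orbT; lia.
case=> [_|l lk].
  rewrite (_ : Ordinal _ = a)//; apply/val_inj.
  by rewrite /= digit0 modnMDl modn_small.
rewrite (_ : Ordinal _ = Ordinal (digit_lt y l b0)) ?yD//.
by apply/val_inj; rewrite /= digitS divnMDl// divn_small// addn0.
Qed.

End DigitPoints.

(** * Digit vectors at one position of a wall *)

Section CountDigitVectors.
Local Open Scope nat_scope.
Context {d b : nat} (A : {set 'I_b}) (m : nat).

(** When [a] is in [A], coordinate [k] is one of the [m] coordinates allowed a digit in [A]; hence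
    the strict inequality. *)
Definition section_digits (k : 'I_d) (a : 'I_b) : {set {ffun 'I_d -> 'I_b}} :=
  [set p : {ffun 'I_d -> 'I_b} | (p k == a) && (#|[set i | (i != k) && (p i \in A)]| < m)].

(** These vectors lie in a product with factor [[set a]] at [k], [A] on [X] and the complement of
    [A] on the other [d - #|X| - 1] coordinates. *)
Lemma card_digits_pattern (k : 'I_d) a (X : {set 'I_d}) : k \notin X ->
  #|[set p : {ffun 'I_d -> 'I_b} |
      (p k == a) && ([set i | (i != k) && (p i \in A)] == X)]|
  <= #|A| ^ #|X| * (b - #|A|) ^ (d - #|X| - 1).
Proof.
move=> kX; pose F i := if i == k then [set a] else if i \in X then A else ~: A.
have -> : #|A| ^ #|X| * (b - #|A|) ^ (d - #|X| - 1) = #|family F|.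
  rewrite card_family foldrE big_map big_enum /= (bigD1 k)//= /F eqxx cards1 mul1n.
  rewrite (bigID (mem X))/=; congr (_ * _).
    rewrite (eq_bigl (mem X)) => [|i]; last first.
      by rewrite /= andb_idl//; apply: contraTneq => ->; exact: kX.
    rewrite (eq_bigr (fun=> #|A|)); last first.
      by move=> i /= iX; rewrite iX; case: eqP iX kX => // ->; move=> ->.
    by rewrite prod_nat_const.
  rewrite (eq_bigr (fun=> b - #|A|)); last first.
    by move=> i /andP[/negbTE-> /negbTE->]; rewrite [LHS](cardsCs (~: A)) card_ord finset.setCK.
  rewrite prod_nat_const; congr (_ ^ _).
  have -> : #|[pred i | (i != k) && (i \notin X)]| = #|~: (k |: X)|.
    by apply: eq_card => i; rewrite !inE negb_or.
  by rewrite cardsCs card_ord finset.setCK cardsU1 kX -subnDA addnC.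
apply/subset_leq_card/fintype.subsetP => p; rewrite inE => /andP[/eqP pk /eqP pX].
apply/familyP => i; rewrite /F; case: eqP => [->|/eqP ik]; first by rewrite inE pk.
by case: ifP; rewrite -pX inE ik/= => // /negbT; rewrite inE.
Qed.

(** Group the vectors by the set [X] of coordinates other than [k] with a digit in [A], then these
    sets by size. *)
Lemma card_section_digits (k : 'I_d) a : #|section_digits k a| <= Nsum d A m.
Proof.
pose t (p : {ffun 'I_d -> 'I_b}) := [set i | (i != k) && (p i \in A)].
pose Q (X : {set 'I_d}) := (X \subset ~: [set k]) && (#|X| < m).
rewrite -sum1_card (partition_big t Q) /=; last first.
  move=> p; rewrite inE /Q => /andP[_ ->]; rewrite andbT.
  by apply/fintype.subsetP => i; rewrite !inE => /andP[].
pose g i := #|A| ^ i * (b - #|A|) ^ (d - i - 1).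
apply: (@leq_trans (\sum_(X | Q X) g #|X|)).
  apply: leq_sum => X /andP[/fintype.subsetP Xk _].
  have kX : k \notin X by apply/negP => /Xk; rewrite !inE eqxx.
  apply: leq_trans (card_digits_pattern a kX); rewrite sum1_card.
  apply/subset_leq_card/fintype.subsetP => p; rewrite !inE.
  by rewrite unfold_in /= inE -andbA => /and3P[-> _ ->].
have [m0|m0] := posnP m; first by rewrite big_pred0// => X; rewrite /Q m0 ltn0 andbF.
(* The modulus only turns [#|X|] into an ordinal; nothing is reduced, as [#|X| < m]. *)
pose o (X : {set 'I_d}) : 'I_m := Ordinal (ltn_pmod #|X| m0).
rewrite (partition_big o xpredT)//= /Nsum leq_sum// => i _.
rewrite (eq_bigr (fun=> g i)) => [|X /andP[/andP[_ Xm] /eqP <-]]; last first.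
  by rewrite /= modn_small.
rewrite sum_nat_const -mulnA leq_mul2r; apply/orP; right.
have -> : d.-1 = #|~: [set k]| by rewrite cardsC1 card_ord.
rewrite -cards_draws; apply/subset_leq_card/fintype.subsetP => X.
rewrite unfold_in /= !inE => /andP[/andP[-> Xm] /eqP <-].
by rewrite /= modn_small.
Qed.

End CountDigitVectors.

(** * Points of a wall in a box *)

Section CountSections.
Local Open Scope nat_scope.
Context {d b : nat} (A : {set 'I_b}) (m : nat).
Context (b3 : 2 < b) (N1 : 0 < Nsum d A m).
Let N := Nsum d A m.

Lemma Nsum_gt0_m : 0 < m.
Proof. by case: m N1 => //; rewrite /Nsum big_ord0. Qed.

(* If [0] is in [A], a point of some [Gamma k'] with [k' < j] may lie on a
   hyperplane [wall b 0 j] although its digits beyond [k'] are unconstrained.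
   Such points are only harmless when [2 <= N], so [a] is taken nonzero
   unless [A] is contained in [{0}]. *)
Definition cutting_digit (a : 'I_b) :=
  (A = finset.set0 \/ a \in A) /\ [\/ A = finset.set0, val a <> 0 | 1 < N].

Lemma cutting_digit_exists : 1 < d -> exists a, cutting_digit a.
Proof.
move=> d2; have b0 : 0 < b by lia.
have [A0|[c cA]] := set_0Vmem A.
  by exists (Ordinal b0); split; [left|apply: Or31].
have [/existsP[a /andP[aA a0]]|/existsPn H] := boolP [exists a in A, val a != 0].
  by exists a; split; [right|apply: Or32; apply/eqP].
exists c; split; [by right|apply: Or33].
have Ac : A = [set c].
  apply/setP => x; rewrite inE; apply/idP/eqP => [xA|->//]; apply: val_inj.
  by have := H x; have := H c; rewrite xA cA /= !negbK => /eqP-> /eqP->.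
(* Here [A] contains only [0], and the term [i = 0] alone is [(b - 1) ^ (d - 1) >= 2]. *)
rewrite /N /Nsum; case: m Nsum_gt0_m => // m' _.
rewrite big_ord_recl bin0 expn0 !mul1n Ac cards1.
apply: leq_trans (leq_addr _ _).
rewrite (@leq_trans ((b - 1) ^ 1))//; first by rewrite expn1; lia.
by rewrite leq_exp2l /=; lia.
Qed.

Context (b0 : 0 < b) (a : 'I_b) (aP : cutting_digit a).

(** In [Gamma_vertex k'] only the first [k'] digits are constrained. At such a digit, taking [k] out
    of [digit_in] leaves at most [m - 1] coordinates. *)
Lemma digit_vector_section k' j x k l : @Gamma_vertex d b A m k' x ->
  wall b a j (x k) -> l < j -> (l < k' \/ A = finset.set0) ->
  digit_vector b0 x l \in section_digits A m k a.
Proof.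
move=> [_ xm] /forallP xw lj lk'; rewrite inE ffunE -val_eqE /=.
have xa := xw (Ordinal lj); rewrite xa /=.
case: aP => [[A0|aA] _].
  rewrite (_ : [set i | _] = finset.set0) ?cards0 ?Nsum_gt0_m//.
  by apply/setP => i; rewrite !inE A0 inE andbF.
case: lk' => [lk'|A0]; last by rewrite A0 inE in aA.
apply: leq_trans (xm l lk'); rewrite (cardsD1 k (digit_in A x l)) inE.
rewrite (_ : [exists _ in A, _]); last by apply/existsP; exists a; rewrite aA xa.
rewrite ltnS; apply/subset_leq_card/fintype.subsetP => i.
rewrite !inE => /andP[-> iA] /=; apply/existsP; exists (digit_vector b0 x l i).
by rewrite iA ffunE /= eqxx.
Qed.

Lemma leq_expn_base n p j : n <= p -> n ^ j <= p ^ j.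
Proof. by move=> np; elim: j => // j IH; rewrite !expnS leq_mul. Qed.

Lemma sum_expn_le n j : 1 < n -> \sum_(k < j) n ^ k <= n ^ j.
Proof.
move=> n1; elim: j => [|j IH]; first by rewrite big_ord0.
rewrite big_ord_recr /= expnS; apply: leq_trans (_ : 2 * n ^ j <= _).
  by rewrite mul2n -addnn leq_add2r.
by rewrite leq_mul2r n1 orbT.
Qed.

Lemma card_wall_box (X : seq (lattice_point d)) (u : 'I_d -> nat) L j k :
  uniq X -> {in X, forall x, [/\ vertex (sponge d A m) x, wall b a j (x k) &
     forall i, u i <= x i < u i + L * b ^ j]} ->
  size X <= (L.+1 ^ d).+1 * N ^ j.
Proof.
move=> uX HX; have bj0 : 0 < b ^ j by rewrite expn_gt0 b0.
pose P := enum (section_digits A m k a).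
have PN : size P <= N by rewrite -cardE; exact: card_section_digits.
(* A point is given by its quotients by [b ^ j] and its last [j] digit vectors. An interval of
   length [L * b ^ j] can meet [L + 1] blocks, as it need not be aligned. *)
pose s1 : seq (lattice_point d) :=
  [seq [ffun i => (u i %/ b ^ j + t i) * b ^ j + y i] |
    t : {ffun 'I_d -> 'I_L.+1} <- enum {: {ffun 'I_d -> 'I_L.+1}},
    y : lattice_point d <- digit_points P j].
(* Points of some [Gamma_vertex k'] with [k' < j]: the sum of the [N ^ k'] is at most [N ^ j] once
   [N >= 2]. *)
pose s2 : seq (lattice_point d) :=
  if 1 < N then flatten [seq digit_points P k' | k' <- iota 0 j] else [::].
have s1E : size s1 <= L.+1 ^ d * N ^ j.
  rewrite size_allpairs size_digit_points -cardE card_ffun !card_ord leq_mul2l.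
  by rewrite leq_expn_base ?PN ?orbT.
have s2E : size s2 <= N ^ j.
  rewrite /s2; case: ifP => // N2; rewrite size_flatten /shape -map_comp.
  apply: leq_trans (sum_expn_le j N2).
  rewrite sumnE big_map -[j in iota 0 j]subn0 -/(index_iota 0 j) big_mkord leq_sum// => i _.
  by rewrite /= size_digit_points leq_expn_base.
rewrite mulSn (leq_trans _ (leq_add s2E s1E))// addnC -size_cat.
apply: uniq_leq_size => // x xX; have [[k' _ xk'] xw xu] := HX x xX.
rewrite mem_cat; have [/orP lk'|] := boolP ((j <= k') || (A == finset.set0)).
  apply/orP; left; apply/allpairsP.
  have tL i : x i %/ b ^ j - u i %/ b ^ j < L.+1.
    have := xu i; rewrite ltnS leq_subLR => /andP[_ xu'].
    rewrite -ltnS ltn_divLR//; apply: leq_trans xu' _.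
    by rewrite mulSn mulnDl addnA leq_add2r {1}(divn_eq (u i) (b ^ j)) addnC
      leq_add2r ltnW// ltn_pmod.
  exists ([ffun i => Ordinal (tL i)], [ffun i => x i %% b ^ j]); split=> /=.
  - by rewrite mem_enum.
  - apply: (@mem_digit_points _ _ b0) => l lj; rewrite mem_enum.
    apply: (digit_vector_section xk' xw lj).
    by case: lk' => [jk|/eqP]; [left; exact: leq_trans jk|right].
  - apply/ffunP => i; rewrite !ffunE /= subnKC -?divn_eq//.
    by apply: leq_div2r; have /andP[] := xu i.
rewrite negb_or -ltnNge => /andP[kj A0]; apply/orP; right.
have [xb _] := xk'; rewrite /s2.
(* Digit [k'] of [x k] is [0] as [x k < b ^ k'], and it is [a] on the wall, so [cutting_digit]
   leaves only this case. *)
have -> : 1 < N.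
  case: aP => _ [A0'|a0|//]; first by rewrite A0' eqxx in A0.
  move/forallP: xw => /(_ (Ordinal kj))/eqP.
  by rewrite /= (@digit_out b _ k')// => /esym.
apply/flatten_mapP; exists k'; first by rewrite mem_iota.
rewrite (_ : x = [ffun i => x i %% b ^ k']).
  apply: (@mem_digit_points _ _ b0) => l lk; rewrite mem_enum.
  by apply: (digit_vector_section xk' xw (ltn_trans lk kj)); left.
by apply/ffunP => i; rewrite ffunE modn_small.
Qed.

End CountSections.

(** * Construction of a small cut set *)

Section SmallCut.
Local Open Scope nat_scope.

Lemma card_bigcup_le (I T : finType) (F : I -> {set T}) :
  #|\bigcup_i F i| <= \sum_i #|F i|.
Proof.
elim/big_rec2: _ => [|i n U _ Un]; first by rewrite cards0.
by apply: leq_trans (leq_card_setU _ _) _; rewrite leq_add2l.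
Qed.

Context {d b : nat} (A : {set 'I_b}) (m : nat).
Context (b3 : 2 < b) (N1 : 0 < Nsum d A m) (a : 'I_b) (aP : cutting_digit (d := d) A m a).
Context (W : {fset lattice_point d}) (e : rel W) (We : finite_subgraph (sponge d A m) e).
Implicit Type S : {set W}.
Let N := Nsum d A m.

Let b0 : 0 < b. Proof. by lia. Qed.
Let bj0 j : 0 < b ^ j. Proof. by rewrite expn_gt0 b0. Qed.

(** Adjacent points differ by one in a single coordinate, so by symmetry only upward steps need to
    be checked. *)
Lemma max_component_lattice_le S (T : eqType) (f : W -> T) :
  (forall (x y : W) (k : 'I_d), x \notin S -> y \notin S ->
    (forall l, l != k -> val x l = val y l) -> val y k = (val x k).+1 -> f x = f y) ->
  (forall x, x \notin S -> 2 * #|[set y | (y \notin S) && (f y == f x)]| <= #|{: W}|) ->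
  2 * max_component e S <= #|{: W}|.
Proof.
move=> fE fc; have [_ _ eW] := We.
rewrite mul2n -geq_half_double.
apply: (@max_component_le _ _ _ _ f); last first.
  by move=> x /fc; rewrite mul2n -geq_half_double.
move=> x y xS yS /eW[k [_ _ /l1dist_eq1P[l [xy [E|E]]]]]; first exact: (fE _ _ l).
by apply/esym/(fE _ _ l) => // i /xy.
Qed.

Lemma card_wall_set S (u : 'I_d -> nat) L j :
  {in S, forall x : W, (exists k : 'I_d, wall b a j (val x k)) /\
     forall i, u i <= val x i < u i + L * b ^ j} ->
  #|S| <= d * ((L.+1 ^ d).+1 * N ^ j).
Proof.
move=> HS; pose F (k : 'I_d) : {set W} := [set x in S | wall b a j (val x k)].
apply: (@leq_trans #|\bigcup_k F k|).
  apply/subset_leq_card/fintype.subsetP => x xS; have [[k xk] _] := HS x xS.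
  by apply/bigcupP; exists k => //; rewrite inE xS.
apply: leq_trans (card_bigcup_le _) _.
rewrite -[X in _ <= X * _]card_ord -sum_nat_const leq_sum// => k _.
rewrite cardE -(size_map val).
apply: (card_wall_box N1 b0 aP (u := u) (k := k)).
  by rewrite map_inj_uniq ?enum_uniq//; exact: val_inj.
move=> _ /mapP[x + ->]; rewrite mem_enum inE => /andP[/HS[_ xu] xk].
by split=> //; have [_ + _] := We; apply.
Qed.

Definition cell_vector B (r : 'I_d -> nat) (x : lattice_point d) : lattice_point d :=
  [ffun i => cell B (r i) (x i)].

Lemma cell_vector_next B r (x y : lattice_point d) k : (forall i, r i < B) ->
  (forall l, l != k -> x l = y l) -> y k = (x k).+1 ->
  cell_vector B r x != cell_vector B r y ->
  [/\ y k = r k %[mod B], cell B (r k) (y k) = (cell B (r k) (x k)).+1 &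
      forall l, l != k -> cell_vector B r x l = cell_vector B r y l].
Proof.
move=> rB xy yk xyc.
have E l : l != k -> cell_vector B r x l = cell_vector B r y l.
  by move=> lk; rewrite !ffunE xy.
have : cell B (r k) (x k) != cell B (r k) (x k).+1.
  apply: contra xyc => /eqP xyk; apply/eqP/ffunP => l.
  by have [->|/E//] := eqVneq l k; rewrite !ffunE yk xyk.
by move/(cell_next (rB k)); rewrite -yk => -[-> ->].
Qed.

(** With this offset the cell boundaries are walls, and those of level [j + 1] are also walls of
    level [j]. *)
Let grid j : 'I_d -> nat := fun=> repdigit b a j.
Let grid_lt j i : grid j i < b ^ j. Proof. exact: repdigit_lt. Qed.
Let grid_wall j (x : lattice_point d) k : x k = grid j k %[mod b ^ j] -> wall b a j (x k).
Proof. exact: wall_mod. Qed.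

Definition on_wall j (x : lattice_point d) := [exists k : 'I_d, wall b a j (x k)].

Definition open_cell j t : {set W} :=
  [set x | (cell_vector (b ^ j) (grid j) (val x) == t) && ~~ on_wall j (val x)].

Lemma cut_big_cell j t :
  #|{: W}| < 2 * #|open_cell j.+1 t| -> (forall t', 2 * #|open_cell j t'| <= #|{: W}|) ->
  exists S, 2 * max_component e S <= #|{: W}| /\
    #|S| <= d * (((2 * b).+1 ^ d).+1 * N ^ j).
Proof.
move=> big small; pose c j (x : W) := cell_vector (b ^ j) (grid j) (val x).
(* The upper faces of cell [t] have index [t i + 1] in some direction, hence two indices. They span
   a box of side [2 * b ^ j.+1], so [L = 2 * b] at level [j]. *)
pose S : {set W} := [set x | [forall i, t i <= c j.+1 x i < t i + 2] && on_wall j (val x)].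
exists S; split; last first.
  apply: (@card_wall_set _ (fun i => t i * b ^ j.+1 - (b ^ j.+1 - grid j.+1 i))) => x.
  rewrite inE => /andP[/forallP xt /existsP xw]; split=> // i.
  by rewrite -mulnA -expnS; apply: cell_bounds => //; have := xt i; rewrite ffunE.
pose f x := if c j.+1 x == t then Some (c j x) else None.
apply: (@max_component_lattice_le _ _ f).
  move=> x y k xS yS xy yk; rewrite /f.
  have inQ z : z \notin S -> c j.+1 z = t -> ~~ on_wall j (val z).
    rewrite inE negb_and => /orP[/forallPn[i]|//] + zt.
    by rewrite zt leqnn addn2 ltnS leqnSn.
  have [xyc|/(cell_vector_next (grid_lt j.+1) xy yk)] := eqVneq (c j.+1 x) (c j.+1 y).
    rewrite -xyc; case: eqP => // xt; congr Some; apply/eqP; apply: contraT.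
    move=> /(cell_vector_next (grid_lt j) xy yk)[/grid_wall yw _ _].
    by have /existsPn/(_ k) := inQ y yS (esym (etrans (esym xt) xyc)); rewrite yw.
  move=> [/grid_wall/wallS yw cyk cyl].
  (* The edge crosses a boundary of level [j + 1], so [y] is on a wall; if either end were in cell
     [t], then [y] would be in [S]. *)
  have ynw : c j.+1 x = t \/ c j.+1 y = t -> False.
    move=> H; move: yS; rewrite inE negb_and; have -> /= : on_wall j (val y).
      by apply/existsP; exists k.
    rewrite orbF => /forallPn[l]; case: H => [xt|->]; last first.
      by rewrite leqnn addn2 ltnS leqnSn.
    rewrite -xt; have [->|lk] := eqVneq l k; last first.
      by rewrite -cyl// leqnn addn2 ltnS leqnSn.
    by rewrite !ffunE cyk addn2 leqnSn leqnn.
  case: eqP => [xt|_]; first by case: ynw; left.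
  by case: eqP => [yt|//]; case: ynw; right.
move=> x xS; rewrite /f; case: eqP => [xt|xt].
  apply: leq_trans (small (c j x)); rewrite leq_mul2l /=.
  apply/subset_leq_card/fintype.subsetP => y; rewrite !inE.
  have [yt|_] := eqVneq (c j.+1 y) t; last by rewrite andbF.
  rewrite negb_and => /andP[+ /eqP[Exy]]; rewrite -/(c j y) Exy eqxx => /orP[|//].
  by move=> /forallPn[i]; rewrite yt leqnn addn2 ltnS leqnSn.
(* The label [None] is found only outside the open cell [t], which by [big] holds more than half. *)
apply: (@leq_trans (2 * #|~: open_cell j.+1 t|)); last first.
  by move: big; rewrite -(cardsC (open_cell j.+1 t)); lia.
rewrite leq_mul2l /=; apply/subset_leq_card/fintype.subsetP => y.
by rewrite !inE -/(c j.+1 y); case: (_ == t); rewrite ?andbF.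
Qed.

Lemma exists_sparse_residue (g : W -> nat) B : 0 < B ->
  exists r, r < B /\ #|[set x | g x %% B == r]| <= #|{: W}| %/ B.
Proof.
move=> B0; apply: contrapT => H.
have : \sum_(r < B) #|[set x | g x %% B == r]| = #|{: W}|.
  rewrite -[RHS]sum1_card (partition_big (fun x => Ordinal (ltn_pmod (g x) B0)) xpredT)//=.
  by apply: eq_bigr => r _; rewrite sum1dep_card; apply: eq_card => x; rewrite !inE.
apply/eqP; rewrite gtn_eqF//; apply: leq_trans (_ : B * (#|{: W}| %/ B).+1 <= _).
  by rewrite mulnC ltn_ceil.
rewrite -[X in X * _]card_ord -sum_nat_const leq_sum// => r _.
by rewrite ltnNge; apply/negP => Hr; apply: H; exists r.
Qed.

(** The sparse residues need not be those of the walls, so a box left by [S1] need not be a cell.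
    Walls inside a big box cut it into parts of small open cells; its side is [b ^ j], so
    [L = 1]. *)
Lemma cut_small_cells j : (forall t, 2 * #|open_cell j t| <= #|{: W}|) ->
  exists S, 2 * max_component e S <= #|{: W}| /\
    #|S| <= d * ((2 ^ d).+1 * N ^ j) + d * (#|{: W}| %/ b ^ j).
Proof.
move=> small.
have /fin_all_exists[r rP] (k : 'I_d) := exists_sparse_residue (fun x => val x k) (bj0 j).
pose S1 : {set W} := \bigcup_(k < d) [set x : W | val x k %% b ^ j == r k].
have S1E : #|S1| <= d * (#|{: W}| %/ b ^ j).
  apply: leq_trans (card_bigcup_le _) _.
  by rewrite -[X in _ <= X * _]card_ord -sum_nat_const leq_sum// => k _; case: (rP k).
have rB k : r k < b ^ j by case: (rP k).
pose box (x : W) := cell_vector (b ^ j) r (val x).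
have boxE (x y : W) k : y \notin S1 -> (forall l, l != k -> val x l = val y l) ->
    val y k = (val x k).+1 -> box x = box y.
  move=> yS xy yk; apply/eqP; apply: contraT => /(cell_vector_next rB xy yk)[H _ _].
  by case/bigcupP: yS; exists k => //; rewrite inE H modn_small.
have [[B big]|nobig] := pselect (exists B, #|{: W}| < 2 * #|[set x | box x == B]|); last first.
  exists S1; split; last by rewrite (leq_trans S1E)// leq_addl.
  apply: (@max_component_lattice_le _ _ box) => [x y k _ yS|x _]; first exact: boxE.
  rewrite leqNgt; apply/negP => H; apply: nobig; exists (box x).
  apply: leq_trans H _; rewrite leq_mul2l /=.
  by apply/subset_leq_card/fintype.subsetP => y; rewrite !inE => /andP[].
pose c (x : W) := cell_vector (b ^ j) (grid j) (val x).
pose S2 : {set W} := [set x | (box x == B) && on_wall j (val x)].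
exists (S1 :|: S2); split; last first.
  apply: leq_trans (leq_card_setU _ _) _; rewrite addnC leq_add//.
  apply: (@card_wall_set _ (fun i => B i * b ^ j - (b ^ j - r i))) => x.
  rewrite inE => /andP[/eqP xB /existsP xw]; split=> // i.
  by apply: cell_bounds => //; rewrite -xB ffunE leqnn addn1 leqnn.
pose f x := if box x == B then Some (c x) else None.
apply: (@max_component_lattice_le _ _ f).
  move=> x y k; rewrite !inE !negb_or => _ /andP[yS1 yS2] xy yk.
  rewrite /f (boxE x y k)//; case: eqP yS2 => //= _ yw; congr Some; apply/eqP.
  apply: contraT => /(cell_vector_next (grid_lt j) xy yk)[/grid_wall yk' _ _].
  by move/existsPn/(_ k): yw; rewrite yk'.
move=> x xS; rewrite /f; case: eqP => [xB|xB].
  apply: leq_trans (small (c x)); rewrite leq_mul2l /=.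
  apply/subset_leq_card/fintype.subsetP => y; rewrite !inE negb_or.
  have [yB|_] := eqVneq (box y) B; last by rewrite andbF.
  by move=> /andP[/andP[_ yw] /eqP[Exy]]; rewrite -/(c y) Exy eqxx.
apply: (@leq_trans (2 * #|~: [set y | box y == B]|)); last first.
  by move: big; rewrite -(cardsC [set y | box y == B]); lia.
rewrite leq_mul2l /=; apply/subset_leq_card/fintype.subsetP => y.
by rewrite !inE; case: (_ == B); rewrite ?andbF.
Qed.

(** Induction on the level, stopping at the first cell with more than half of the vertices; a cut
    found at a lower level is cheap enough because [N >= 1]. *)
Lemma small_cut j : 0 < d -> exists S, 2 * max_component e S <= #|{: W}| /\
  #|S| <= d * (((2 * b).+1 ^ d).+1 * N ^ j) + d * (#|{: W}| %/ b ^ j).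
Proof.
move=> d0.
have : (forall t, 2 * #|open_cell j t| <= #|{: W}|) \/
    exists S, 2 * max_component e S <= #|{: W}| /\
      #|S| <= d * (((2 * b).+1 ^ d).+1 * N ^ j).
  elim: j => [|j [small|[S [Smax Scard]]]].
  (* At level [0] the wall condition is vacuous, so every point is on a wall. *)
  - left=> t; rewrite (_ : open_cell 0 t = finset.set0) ?cards0//.
    apply/setP => x; rewrite !inE; apply/andP => -[_ /existsPn/(_ (Ordinal d0))].
    by apply/negP; rewrite negbK; apply/forallP => -[].
  - have [[t big]|nobig] := pselect (exists t, #|{: W}| < 2 * #|open_cell j.+1 t|).
      have [S [Smax Scard]] := cut_big_cell big small.
      right; exists S; split=> //; apply: leq_trans Scard _.
      by rewrite !leq_mul2l leq_pexp2l// !orbT.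
    by left=> t; rewrite leqNgt; apply/negP => H; apply: nobig; exists t.
  - right; exists S; split=> //; apply: leq_trans Scard _.
    by rewrite !leq_mul2l leq_pexp2l// !orbT.
move=> [/cut_small_cells|] [S [Smax Scard]]; exists S; split=> //.
  apply: leq_trans Scard _; rewrite leq_add2r leq_mul2l leq_mul2r ltnS.
  by rewrite leq_expn_base ?orbT//; lia.
by rewrite (leq_trans Scard)// leq_addr.
Qed.

End SmallCut.

(** * Lower bound *)

Section GridOfLines.
Local Open Scope nat_scope.
Context {d B : nat} (C : {set 'I_B}).
Notation point := {ffun 'I_d -> 'I_B}.
Implicit Types (p q w : point) (i : 'I_d).

Definition collinear i p q := [forall l, (l != i) ==> (p l == q l)].
Definition on_line i p := [forall l, (l != i) ==> (p l \in C)].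
Definition on_some_line p := [exists i, on_line i p].
Definition update p i c : point := [ffun l => if l == i then c else p l].

Context {V : finType} (e : rel V) (pt : V -> point).
Hypotheses (e_sym : symmetric e) (pt_inj : injective pt)
  (pt_line : forall v, on_some_line (pt v))
  (pt_surj : forall p, on_some_line p -> exists v, pt v = p)
  (pt_edge : forall u v i, collinear i (pt u) (pt v) -> pt v i = (pt u i).+1 :> nat -> e u v).
Hypotheses (d0 : 0 < d) (C0 : 0 < #|C|).

Context (S : {set V}).

(** Only the start is asked to avoid [S]: every step of [del_edge] avoids it, so the end does
    too. *)
Definition linked p q := exists u v,
  [/\ pt u = p, pt v = q, u \notin S & connect (del_edge e S) u v].

Definition touched i p := [exists s in S, collinear i p (pt s)].

Lemma collinearP i p q : reflect (forall l, l != i -> p l = q l) (collinear i p q).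
Proof.
apply: (iffP forallP) => [H l li|H l]; first by have := H l; rewrite li => /eqP.
by apply/implyP => /H ->.
Qed.

Lemma on_line_update i p c : on_line i (update p i c) = on_line i p.
Proof. by apply: eq_forallb => l; rewrite ffunE; case: eqVneq. Qed.

Lemma update_id p i : update p i (p i) = p.
Proof. by apply/ffunP => l; rewrite ffunE; case: eqVneq => // ->. Qed.

Lemma linked_trans p q w : linked p q -> linked q w -> linked p w.
Proof.
move=> [u [v [<- <- uS uv]]] [v' [x [/pt_inj-> <- _ vx]]].
by exists u, x; split=> //; exact: connect_trans vx.
Qed.

Lemma linked_sym p q : linked p q -> linked q p.
Proof.
move=> [u [v [<- <- uS uv]]]; exists v, u; split=> //.
  have uvC : v \in component e S u by rewrite inE.
  by have [] := component_invariant (f := fun=> tt) (fun _ _ _ _ _ => erefl) uS uvC.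
rewrite sym_connect_sym//.
by move=> x y; rewrite /del_edge /= e_sym andbCA.
Qed.

(** An untouched line loses no vertex, and its consecutive points are adjacent, so it survives as a
    path. *)
Lemma line_linked i p c c' : on_line i p -> ~~ touched i p ->
  linked (update p i c) (update p i c').
Proof.
move=> ip tp.
have vx k : exists v, pt v = update p i k /\ v \notin S.
  have [|v vE] := pt_surj (p := update p i k).
    by apply/existsP; exists i; rewrite on_line_update.
  exists v; split=> //; apply: contra tp => vS; apply/existsP; exists v.
  by rewrite vS /= vE; apply/collinearP => l li; rewrite ffunE (negbTE li).
have B0 : 0 < B by case: (B) c => // -[].
suff H k : linked (update p i (Ordinal B0)) (update p i k).
  exact: linked_trans (linked_sym (H c)) (H c').
case: k => k; elim: k => [|k IH] kB.
  have [v [vE vS]] := vx (Ordinal kB); exists v, v; split=> //.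
  by rewrite vE; congr update; apply: val_inj.
apply: linked_trans (IH (ltnW kB)) _.
have [u [uE uS]] := vx (Ordinal (ltnW kB)); have [v [vE vS]] := vx (Ordinal kB).
exists u, v; split=> //; apply: connect1; rewrite /del_edge /= uS vS /=.
apply: (pt_edge (i := i)); rewrite uE vE; last by rewrite !ffunE eqxx.
by apply/collinearP => l li; rewrite !ffunE (negbTE li).
Qed.

Definition all_in p := [forall l, p l \in C].

Lemma all_in_on_line p i : all_in p -> on_line i p.
Proof. by move=> /forallP pC; apply/forallP => l; rewrite pC implybT. Qed.

(** Corners of the path from [p] to [q] that replaces the coordinates in increasing order. *)
Definition mix (k : nat) p q : point := [ffun l : 'I_d => if l < k then q l else p l].

Lemma mix_linked p q : all_in p -> all_in q ->
  (forall i, ~~ touched i (mix i p q)) -> linked p q.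
Proof.
move=> /forallP pC /forallP qC pq.
have mixC k : all_in (mix k p q) by apply/forallP => l; rewrite ffunE; case: ifP.
have mixE (i : 'I_d) : linked (mix i p q) (mix i.+1 p q).
  rewrite -[X in linked X _](update_id _ i).
  rewrite (_ : mix i.+1 p q = update (mix i p q) i (q i)).
    by apply: line_linked => //; exact: all_in_on_line.
  apply/ffunP => l; rewrite !ffunE ltnS leq_eqVlt (inj_eq val_inj).
  by case: eqVneq => // ->.
have H k : k < d -> linked (mix 0 p q) (mix k.+1 p q).
  elim: k => [|k IH] kd; first exact: (mixE (Ordinal kd)).
  exact: linked_trans (IH (ltnW kd)) (mixE (Ordinal kd)).
have := H d.-1; rewrite prednK// leqnn => /(_ isT).
have -> : mix 0 p q = p by apply/ffunP => l; rewrite ffunE.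
by have -> : mix d p q = q by apply/ffunP => l; rewrite ffunE ltn_ord.
Qed.

Let Q := #|C|.

Lemma card_family_prod (F : 'I_d -> {set 'I_B}) :
  #|[set p : point | [forall l, p l \in F l]]| = \prod_l #|F l|.
Proof.
transitivity #|family F|; last by rewrite card_family foldrE big_map big_enum.
by apply: eq_card => p; rewrite inE; apply/forallP/familyP.
Qed.

Lemma card_all_in : #|[set p | all_in p]| = Q ^ d.
Proof. by rewrite (card_family_prod (fun=> C)) prod_nat_const card_ord. Qed.

(** If segment [i] of the path is on the line of [s], then [s] fixes [q] before coordinate [i] and
    [p] after it. This leaves [p] up to [i] and [q] from [i] on, [d + 1] free coordinates. *)
Lemma card_blocked_pairs i (s : point) :
  #|[set pq : point * point | [&& all_in pq.1, all_in pq.2 & collinear i (mix i pq.1 pq.2) s]]|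
  <= Q ^ d.+1.
Proof.
pose F1 (l : 'I_d) := if i < l then [set s l] else C.
pose F2 (l : 'I_d) := if l < i then [set s l] else C.
apply: (@leq_trans #|finset.setX [set p : point | [forall l, p l \in F1 l]]
                                [set p : point | [forall l, p l \in F2 l]]|).
  apply/subset_leq_card/fintype.subsetP => -[p q]; rewrite !inE /=.
  move=> /and3P[/forallP pC /forallP qC /collinearP pqs].
  apply/andP; split; apply/forallP => l; rewrite /F1 /F2; case: ifP => // li;
    rewrite inE -pqs ?ffunE ?li//; try by rewrite -val_eqE neq_ltn li ?orbT.
  by rewrite ltnNge ltnW.
rewrite cardsX !card_family_prod -big_split /= (bigD1 i)//= /F1 /F2 ltnn.
rewrite (eq_bigr (fun=> Q)) => [|l li]; last first.
  by case: ltngtP => [_|_|/val_inj le]; rewrite ?cards1 ?mul1n ?muln1//; rewrite le eqxx in li.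
rewrite prod_nat_const (_ : #|_| = d.-1); last first.
  by rewrite -[in RHS](card_ord d) -(cardC1 i); apply: eq_card => l; rewrite !inE.
by rewrite -mulnA -expnS prednK// -expnS.
Qed.

Definition blocked p q := [exists i, touched i (mix i p q)].

Lemma card_blocked : #|[set pq : point * point | [&& all_in pq.1, all_in pq.2 &
  blocked pq.1 pq.2]]| <= d * (#|S| * Q ^ d.+1).
Proof.
pose F (is_ : 'I_d * {s | s \in S}) := [set pq : point * point |
  [&& all_in pq.1, all_in pq.2 & collinear is_.1 (mix is_.1 pq.1 pq.2) (pt (val is_.2))]].
apply: (@leq_trans #|\bigcup_k F k|).
  apply/subset_leq_card/fintype.subsetP => -[p q]; rewrite inE /=.
  move=> /and3P[pC qC /existsP[i /existsP[s /andP[sS is_]]]].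
  by apply/bigcupP; exists (i, exist _ s sS) => //; rewrite inE /= pC qC is_.
apply: leq_trans (card_bigcup_le _) _.
apply: (@leq_trans (\sum_(k : 'I_d * {s | s \in S}) Q ^ d.+1)).
  by apply: leq_sum => k _; exact: card_blocked_pairs.
by rewrite sum_nat_const card_prod card_ord card_sig mulnA.
Qed.

(** Average [card_blocked] over the [Q ^ d] choices of [p]. *)
Lemma exists_central_point : exists p, all_in p /\
  #|[set q | all_in q && blocked p q]| <= d * (#|S| * Q).
Proof.
apply: contrapT => H; have := card_blocked; apply/negP; rewrite -ltnNge.
apply: (@leq_trans (\sum_(p in [set p | all_in p]) (d * (#|S| * Q)).+1)).
  rewrite sum_nat_const card_all_in mulnS -[X in X < _]add0n.
  by rewrite expnS [d * _]mulnC [_ ^ d * _]mulnC -!mulnA (mulnC d) -!mulnA ltn_add2r expn_gt0 C0.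
rewrite -[X in _ <= X]sum1_card (partition_big fst (mem [set p | all_in p])) /=; last first.
  by move=> [p q]; rewrite !inE => /andP[].
apply: leq_sum => p; rewrite inE => pC; rewrite ltnNge; apply/negP => Hp.
apply: H; exists p; split=> //; apply: leq_trans Hp.
rewrite sum1_card -(card_imset _ (_ : injective (pair p))); last by move=> ? ? [].
apply/subset_leq_card/fintype.subsetP => _ /imsetP[q + ->].
by rewrite !inE unfold_in /= inE /= pC eqxx andbT.
Qed.

Lemma card_touched i : #|[set p | touched i p]| <= #|S| * B.
Proof.
rewrite -[X in _ * X]card_ord -cardsT -cardsX.
apply: leq_trans (leq_imset_card (fun sc : V * 'I_B => update (pt sc.1) i sc.2) _).
apply/subset_leq_card/fintype.subsetP => p; rewrite inE => /existsP[s /andP[sS /collinearP ps]].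
apply/imsetP; exists (s, p i); first by rewrite !inE sS.
by apply/ffunP => l; rewrite ffunE /=; case: eqVneq => [->|/ps].
Qed.

(** Double counting: moving [p] in [X] along its line to [c] in [C] gives a point of [C^d] off [K].
    Remembering the old coordinate [p i], one of [B] values, makes this injective. *)
Lemma card_off_lines i (K : {set V}) (X : {set point}) :
  (forall p q, p \in X -> all_in q -> collinear i p q -> q \in [set pt v | v in ~: K]) ->
  (forall p, p \in X -> on_line i p) ->
  #|X| * Q <= #|[set v | (v \notin K) && all_in (pt v)]| * B.
Proof.
move=> XK Xi; rewrite /Q -(card_imset _ pt_inj) -[X in _ <= _ * X]card_ord -cardsT -!cardsX.
pose f (pc : point * 'I_B) := (update pc.1 i pc.2, pc.1 i).
rewrite -(card_in_imset (f := f) (D := finset.setX X C)); last first.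
  move=> [p c] [q c'] _ _ [pq]; rewrite /= => pqi.
  have : forall l, update p i c l = update q i c' l by move=> l; rewrite pq.
  move=> H; congr (_, _); last by have := H i; rewrite !ffunE eqxx.
  apply/ffunP => l; have := H l; rewrite !ffunE.
  by have [->|//] := eqVneq l i.
apply/subset_leq_card/fintype.subsetP => _ /imsetP[[p c] + ->].
rewrite !inE /= andbT => /andP[pX cC].
have upC : all_in (update p i c).
  apply/forallP => l; rewrite ffunE; case: eqVneq => // li.
  by have /forallP/(_ l) := Xi p pX; rewrite li.
have /imsetP[v vK vE] : update p i c \in [set pt v | v in ~: K].
  apply: (XK p) => //; apply/collinearP => l li; by rewrite ffunE (negbTE li).
by rewrite !inE in vK; apply/imsetP; exists v => //; rewrite inE vK -vE upC.
Qed.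

Lemma card_on_line i : #|[set p | on_line i p]| = Q ^ d.-1 * B.
Proof.
pose F (l : 'I_d) : {set 'I_B} := if l == i then [set: 'I_B] else C.
transitivity #|[set p : point | [forall l, p l \in F l]]|.
  apply: eq_card => p; rewrite !inE; apply: eq_forallb => l.
  by rewrite /F; case: eqVneq => //=; rewrite inE.
rewrite card_family_prod (bigD1 i)//= /F eqxx cardsT card_ord mulnC; congr (_ * _).
rewrite (eq_bigr (fun=> Q)) => [|l /negbTE->//].
rewrite prod_nat_const; congr (_ ^ _).
by rewrite -[in RHS](card_ord d) -(cardC1 i); apply: eq_card => l; rewrite !inE.
Qed.

Lemma card_on_some_line : #|[set p | on_some_line p]| <= d * (Q ^ d.-1 * B).
Proof.
apply: (@leq_trans #|\bigcup_i [set p | on_line i p]|).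
  apply/subset_leq_card/fintype.subsetP => p; rewrite inE => /existsP[i pi].
  by apply/bigcupP; exists i => //; rewrite inE.
apply: leq_trans (card_bigcup_le _) _.
rewrite (eq_bigr (fun=> Q ^ d.-1 * B)) => [|i _]; last exact: card_on_line.
by rewrite sum_nat_const card_ord.
Qed.

Lemma card_vertices_ge : Q ^ d.-1 * B <= #|V|.
Proof.
rewrite -(card_on_line (Ordinal d0)) -cardsT -(card_imset _ pt_inj).
apply/subset_leq_card/fintype.subsetP => p; rewrite inE => pl.
have [|v <-] := @pt_surj p; last by rewrite imset_f ?inE.
by apply/existsP; exists (Ordinal d0).
Qed.

(** A vertex off the component [K] of the central point is on a touched line (at most [#|S| * B] per
    direction) or on an untouched line missing [K] (at most [d * #|S| * B]). These must make up half
    of at least [Q ^ d.-1 * B] vertices. *)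
Lemma cutset_lower_bound : 2 * max_component e S <= #|V| ->
  Q ^ d.-1 <= 4 * d ^ 2 * #|S|.
Proof.
move=> Smax; rewrite leqNgt; apply/negP => Ssmall.
have [p [pC pblocked]] := exists_central_point.
have pq q : all_in q -> ~~ blocked p q -> linked p q.
  by move=> qC /existsPn npq; exact: mix_linked.
(* A single unblocked [q] shows that the vertex at [p] is not removed. *)
have [q qC qb] : exists2 q, all_in q & ~~ blocked p q.
  apply: contrapT => H; move: pblocked; apply/negP; rewrite -ltnNge.
  rewrite (_ : [set q | _] = [set q | all_in q]); last first.
    apply/setP => q; rewrite !inE andb_idr// => qC.
    by apply: contrapT => /negP nb; apply: H; exists q.
  rewrite card_all_in -(prednK d0) expnSr mulnA ltn_mul2r C0 /=.
  apply: leq_trans Ssmall; rewrite ltnS prednK// leq_mul2r.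
  by apply/orP; right; nia.
have [u [_ [up _ uS _]]] := pq q qC qb.
pose K := component e S u.
have KP v : linked p (pt v) -> v \in K.
  by move=> [u' [v' []]]; rewrite -up => /pt_inj-> /pt_inj-> _; rewrite inE.
have badE : #|[set v | (v \notin K) && all_in (pt v)]| <= d * (#|S| * Q).
  apply: leq_trans pblocked; rewrite -(card_imset _ pt_inj).
  apply/subset_leq_card/fintype.subsetP => _ /imsetP[v + ->]; rewrite !inE.
  move=> /andP[vK vC]; rewrite vC /=; apply: contraR vK => nb.
  by have := KP v (pq _ vC nb); rewrite inE.
(* An untouched line is connected, so if one of its points is off [K], all are, as [card_off_lines]
   requires. *)
pose X i : {set point} := [set w | [&& on_line i w, ~~ touched i w & w \in [set pt v | v in ~: K]]].
have XE i : #|X i| <= d * (#|S| * B).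
  have : #|X i| * Q <= (d * (#|S| * B)) * Q.
    apply: leq_trans (_ : d * (#|S| * Q) * B <= _); last first.
      by rewrite -!mulnA leq_mul2l leq_mul2l (mulnC Q) leqnn !orbT.
    apply: leq_trans (leq_mul badE (leqnn B)); apply: (@card_off_lines i); last first.
      by move=> w; rewrite inE => /and3P[].
    move=> w w'; rewrite inE => /and3P[wi wt /imsetP[v vK vE]] w'C ww'.
    have w'i := all_in_on_line i w'C.
    have [v' v'E] : exists v', pt v' = w' by apply: pt_surj; apply/existsP; exists i.
    apply/imsetP; exists v' => //; rewrite !inE; rewrite !inE in vK.
    apply: contra vK => v'K; apply: connect_trans v'K _.
    have : linked w' w.
      rewrite -(update_id w' i) -(update_id w i).
      rewrite (_ : update w i (w i) = update w' i (w i)).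
        apply: line_linked => //; apply: contra wt => /existsP[s /andP[sS /collinearP w's]].
        apply/existsP; exists s; rewrite sS; apply/collinearP => l li.
        by rewrite -w's//; apply/(collinearP _ _ _ ww').
      apply/ffunP => l; rewrite !ffunE; case: eqVneq => // li.
      by apply/(collinearP _ _ _ ww').
    by move=> [x [y []]]; rewrite vE -v'E => /pt_inj-> /pt_inj->.
  by rewrite leq_pmul2r.
have KCE : #|~: K| <= d * (#|S| * B + d * (#|S| * B)).
  rewrite -(card_imset _ pt_inj).
  apply: (@leq_trans #|\bigcup_i ([set w | touched i w] :|: X i)|).
    apply/subset_leq_card/fintype.subsetP => _ /imsetP[v vK ->].
    have /existsP[i vi] := pt_line v; apply/bigcupP; exists i => //.
    by rewrite !inE vi imset_f// andbT orbN.
  apply: leq_trans (card_bigcup_le _) _.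
  apply: (@leq_trans (\sum_(i < d) (#|S| * B + d * (#|S| * B)))).
    apply: leq_sum => i _; apply: leq_trans (leq_card_setU _ _) _.
    by rewrite leq_add// card_touched.
  by rewrite sum_nat_const card_ord.
have Kmax : #|K| <= max_component e S by rewrite /max_component (bigD1 u)//= leq_maxl.
have VK : #|V| <= 2 * #|~: K|.
  by rewrite -(cardsC K) in Smax *; lia.
have B0 : 0 < B by case: (B) (p (Ordinal d0)) => // -[].
have : Q ^ d.-1 * B <= (4 * d ^ 2 * #|S|) * B.
  apply: leq_trans card_vertices_ge _; apply: leq_trans VK _.
  apply: leq_trans (leq_mul (leqnn 2) KCE) _.
  by clear -d0; set s := #|S|; nia.
by rewrite leq_pmul2r// leqNgt Ssmall.
Qed.

End GridOfLines.

(** * The grid of lines inside the sponge for [m = 1] *)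

Section LineGrid.
Local Open Scope nat_scope.
Context {d b : nat} (A : {set 'I_b}) (k : nat).
Context (d0 : 0 < d) (b0 : 0 < b) (q0 : 0 < b - #|A|).
Let q := b - #|A|.
Let B := b ^ k.
Let B0 : 0 < B. Proof. by rewrite expn_gt0 b0. Qed.

Definition digits_outside : {set 'I_B} :=
  [set x : 'I_B | val x \in numbers_with_digits (enum (~: A)) k].

Lemma card_digits_outside : #|digits_outside| = q ^ k.
Proof.
have -> : q ^ k = size (numbers_with_digits (enum (~: A)) k).
  by rewrite size_numbers_with_digits -cardE (cardsCs (~: A)) finset.setCK card_ord.
have mB x : x \in numbers_with_digits (enum (~: A)) k -> x < B.
  by case/(numbers_with_digitsP b0).
rewrite cardE -(size_map val); apply/perm_size/uniq_perm.
- by rewrite map_inj_uniq ?enum_uniq//; exact: val_inj.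
- by apply: uniq_numbers_with_digits => //; exact: enum_uniq.
move=> x; apply/mapP/idP => [[y + ->]|xD]; first by rewrite mem_enum inE.
by exists (Ordinal (mB x xD)); rewrite ?mem_enum ?inE.
Qed.

Lemma digits_outsideP x l : x \in digits_outside -> l < k ->
  Ordinal (digit_lt x l b0) \notin A.
Proof. by rewrite inE => /(numbers_with_digitsP b0)[_ H] /H; rewrite mem_enum inE. Qed.

Let point := {ffun 'I_d -> 'I_B}.
Definition point_nat (p : point) : lattice_point d := [ffun i => val (p i)].

Lemma point_natE p i : point_nat p i = p i.
Proof. by rewrite ffunE. Qed.

(** Reduction modulo [B] makes this total; inside the cube it changes nothing. *)
Definition nat_point (x : lattice_point d) : point :=
  [ffun i => Ordinal (ltn_pmod (x i) B0)].

Lemma point_natK : cancel point_nat nat_point.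
Proof.
by move=> p; apply/ffunP => i; rewrite !ffunE; apply: val_inj; rewrite /= modn_small.
Qed.

Definition line_grid : {fset lattice_point d} :=
  seq_fset tt [seq point_nat p | p <- enum [set p : point | on_some_line digits_outside p]].

Lemma line_gridP x :
  reflect (exists2 p, on_some_line digits_outside p & x = point_nat p) (x \in line_grid).
Proof.
rewrite seq_fsetE; apply: (iffP mapP) => -[p pH ->]; exists p => //.
  by rewrite mem_enum inE in pH.
by rewrite mem_enum inE.
Qed.

Lemma card_line_grid : #|` line_grid| <= d * (q ^ d.-1 * b) ^ k.
Proof.
rewrite size_seq_fset undup_id; last first.
  by rewrite map_inj_uniq ?enum_uniq//; exact: can_inj point_natK.
rewrite size_map -cardE; apply: leq_trans (card_on_some_line _) _.
by rewrite card_digits_outside -expnM (mulnC k) expnM -expnMn.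
Qed.

(** Only the free coordinate of a line can have digits in [A]. *)
Lemma line_grid_Gamma x : x \in line_grid -> @Gamma_vertex d b A 1 k x.
Proof.
move=> /line_gridP[p /existsP[i /forallP pi] ->]; split=> [l|j jk].
  by rewrite ffunE /=; exact: ltn_ord.
rewrite -(cards1 i); apply/subset_leq_card/fintype.subsetP => l; rewrite !inE.
apply: contraLR => li; rewrite negb_exists; apply/forallP => a.
apply/negP => /andP[aA]; rewrite ffunE => pa.
have := pi l; rewrite li => /digits_outsideP /(_ jk).
by rewrite (_ : Ordinal _ = a) ?aA//; apply: val_inj; apply/eqP.
Qed.

Definition line_grid_edge : rel line_grid := fun x y => l1dist (val x) (val y) == 1.

Lemma line_grid_edge_sym : symmetric line_grid_edge.
Proof.
move=> x y; rewrite /line_grid_edge /l1dist; congr (_ == _).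
by apply: eq_bigr => i _; rewrite distnC.
Qed.

Lemma line_grid_subgraph : finite_subgraph (sponge d A 1) line_grid_edge.
Proof.
split; first exact: line_grid_edge_sym.
- by move=> x; exists k => //; apply: line_grid_Gamma; exact: valP.
- by move=> x y /eqP xy; exists k; split=> //; apply: line_grid_Gamma; exact: valP.
Qed.

Lemma line_grid_cut (S : {set line_grid}) :
  2 * max_component line_grid_edge S <= #|{: line_grid}| ->
  (q ^ d.-1) ^ k <= 4 * d ^ 2 * #|S|.
Proof.
rewrite -expnM (mulnC _ k) expnM -card_digits_outside.
have ptK (v : line_grid) : point_nat (nat_point (val v)) = val v.
  by have /line_gridP[p _ ->] := valP v; rewrite point_natK.
apply: (@cutset_lower_bound _ _ _ _ _ (fun v => nat_point (val v))) => //.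
- exact: line_grid_edge_sym.
- by move=> u v uv; apply: val_inj; rewrite -ptK uv ptK.
- by move=> v; have /line_gridP[p pl ->] := valP v; rewrite point_natK.
- move=> p pl; have pW : point_nat p \in line_grid by apply/line_gridP; exists p.
  by exists [` pW]%fset; rewrite /= point_natK.
- move=> u v i /collinearP uv uvi; apply/eqP.
  rewrite -(ptK u) -(ptK v); apply: (@l1dist1 _ _ _ i); last by rewrite !point_natE.
  by move=> l /uv E; rewrite !point_natE E.
- by rewrite card_digits_outside expn_gt0 q0.
Qed.

End LineGrid.

(** * Separation at one half and the growth exponent *)

Section SeparationBounds.
Context {R : realType}.
Let half : R := 2^-1.

Lemma is_cutset_half (V : finType) (e : rel V) (S : {set V}) :
  is_cutset e half S = (2 * max_component e S <= #|V|)%N.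
Proof.
rewrite /is_cutset /half mulrC ler_pdivlMr ?ltr0n//.
by rewrite -natrM ler_nat mulnC.
Qed.

Lemma vertex_cut_half_le (V : finType) (e : rel V) (S : {set V}) :
  (2 * max_component e S <= #|V|)%N -> (vertex_cut e half <= #|S|)%N.
Proof.
rewrite -is_cutset_half /vertex_cut => SC.
by case: arg_minnP => [|S' _]; [apply: is_cutset_setT; rewrite invr_ge0|apply].
Qed.

Lemma vertex_cut_half_ex (V : finType) (e : rel V) : exists S : {set V},
  (2 * max_component e S <= #|V|)%N /\ vertex_cut e half = #|S|.
Proof.
rewrite /vertex_cut; case: arg_minnP => [|S SC _].
  by apply: is_cutset_setT; rewrite invr_ge0.
by exists S; rewrite -is_cutset_half.
Qed.

Lemma sep_le (T : choiceType) (X : graph T) n (c : R) :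
  (forall (W : {fset T}) (e : rel W), finite_subgraph X e -> (#|` W| <= n)%N ->
    (vertex_cut e half)%:R <= c) -> sep half X n <= c.
Proof.
move=> H; apply: ge_sup; first by case: (has_sup_cut_values half X n).
by move=> _ [W [e [We Wn ->]]]; exact: H.
Qed.

Lemma sep_ge (T : choiceType) (X : graph T) n (W : {fset T}) (e : rel W) :
  finite_subgraph X e -> (#|` W| <= n)%N -> (vertex_cut e half)%:R <= sep half X n.
Proof.
move=> We Wn; apply: ub_le_sup; first by case: (has_sup_cut_values half X n).
by exists W, e.
Qed.

Lemma preceq_le (f g : nat -> R) (c : R) n0 : 0 < c ->
  (forall n, (n0 <= n)%N -> 0 <= f n <= c * g n) -> (forall n, 0 <= g n) -> preceq f g.
Proof.
move=> c0 fg g0; apply/eqO_exP; exists c => //.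
exists n0 => // n /= n0n; have /andP[f0 fn] := fg n n0n.
by rewrite !ger0_norm.
Qed.

Context (b N : nat) (b1 : (1 < b)%N) (N0 : (0 < N)%N).
Let E : R := growth_exponent b N.

Lemma lnN_ge0 : 0 <= ln (N%:R : R).
Proof. by rewrite ln_ge0// ler1n. Qed.

Lemma lnb_gt0 : 0 < ln (b%:R : R).
Proof. by rewrite ln_gt0// ltr1n. Qed.

Lemma growth_exponent_ge0 : 0 <= E.
Proof. by rewrite divr_ge0// ?lnN_ge0// addr_ge0 ?lnN_ge0// ltW// lnb_gt0. Qed.

(** [E] is chosen so that [E * ln (N * b) = ln N]. *)
Lemma powR_growth_exponent i : ((N * b) ^ i)%N%:R `^ E = (N ^ i)%N%:R :> R.
Proof.
have NR : 0 < (N%:R : R) by rewrite ltr0n.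
have bR : 0 < (b%:R : R) by rewrite ltr0n ltnW.
rewrite -(@lnK _ ((N ^ i)%N%:R)) ?posrE ?ltr0n ?expn_gt0 ?N0//.
rewrite /powR ifF; last first.
  by rewrite pnatr_eq0 gtn_eqF// expn_gt0 muln_gt0 N0 ltnW.
congr expR; rewrite !natrX natrM !lnXn ?mulr_gt0//.
rewrite lnM ?posrE// /E /growth_exponent mulrnAr divfK//.
by rewrite gt_eqF// ltr_wpDl ?lnN_ge0 ?lnb_gt0.
Qed.

Lemma ler_powR_growth_exponent (x y : R) : 0 <= x -> x <= y -> x `^ E <= y `^ E.
Proof.
move=> x0 xy; apply: ge0_ler_powR; rewrite ?nnegrE ?growth_exponent_ge0//.
exact: le_trans xy.
Qed.

End SeparationBounds.

(** * Bounds for the sponge *)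

Section SpongeSeparation.
Context {R : realType}.
Let half : R := 2^-1.

Lemma sep_ge0 (T : choiceType) (X : graph T) n : 0 <= sep half X n.
Proof.
have [[_ [W [e [We Wn _]]]] _] := has_sup_cut_values half X n.
exact: le_trans (ler0n _ _) (sep_ge We Wn).
Qed.

Context (d b : nat) (A : {set 'I_b}) (m : nat).
Context (d2 : (1 < d)%N) (b3 : (2 < b)%N) (N1 : (0 < Nsum d A m)%N).
Let N := Nsum d A m.
Let E : R := growth_exponent b N.

Let Nb_gt1 : (1 < N * b)%N.
Proof. by rewrite (leq_trans _ (leq_pmull b N1))// ltnW. Qed.

Lemma sep_sponge_le : exists2 c : nat, (0 < c)%N &
  forall n, (0 < n)%N -> sep half (sponge d A m) n <= c%:R * n%:R `^ E.
Proof.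
have [a aP] := cutting_digit_exists b3 N1 d2.
(* The first term pays for the walls, the second for the sparse hyperplanes: [n < (N * b) ^ i.+1]
   gives [n %/ b ^ i <= N * b * N ^ i]. *)
pose c := (d * ((2 * b).+1 ^ d).+1 + d * (N * b))%N.
exists c => [|n n0]; first by rewrite addn_gt0 muln_gt0 ltnW.
pose i := trunc_log (N * b) n.
have /andP[ni nSi] := trunc_log_bounds Nb_gt1 n0.
apply: (@le_trans _ _ (c * N ^ i)%N%:R); last first.
  rewrite natrM ler_wpM2l//; rewrite -(powR_growth_exponent (ltnW b3) N1).
  by rewrite ler_powR_growth_exponent ?ler_nat// ltnW.
apply: sep_le => W e We Wn; rewrite ler_nat.
have [S [Smax SE]] := small_cut b3 N1 aP We i (ltnW d2).
apply: leq_trans (vertex_cut_half_le Smax) _; apply: leq_trans SE _.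
rewrite /c mulnDl -!mulnA !leq_add// leq_mul2l; apply/orP; right.
rewrite -ltnS ltn_divLR ?expn_gt0 ?(ltnW (ltnW b3))// -cardfE.
apply: leq_ltn_trans Wn _; apply: leq_trans nSi _.
by rewrite expnMn !expnS -/i mulSn; nia.
Qed.

Lemma sep_sponge1_ge : m = 1%N -> exists2 c : nat, (0 < c)%N &
  forall n, (d <= n)%N -> n%:R `^ E <= c%:R * d%:R `^ E * sep half (sponge d A m) n.
Proof.
move=> m1.
have NE : N = ((b - #|A|) ^ d.-1)%N.
  by rewrite /N m1 /Nsum big_ord1 bin0 !mul1n /= subn0 subn1.
have q0 : (0 < b - #|A|)%N.
  by have := N1; rewrite -/N NE expn_gt0 => /orP[//|]; lia.
have d0 := ltnW d2.
(* [4 * d ^ 2] comes from [line_grid_cut]; [N] absorbs the passage from [N ^ k.+1] to [N ^ k]. *)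
exists (4 * d ^ 2 * N)%N => [|n dn].
  by rewrite (muln_gt0 (4 * d ^ 2)) (muln_gt0 4) expn_gt0 N1 d0.
have b0 : (0 < b)%N by rewrite (ltnW (ltnW b3)).
(* The largest [k] with [d * (N * b) ^ k <= n], so that [line_grid] has at most [n] vertices. *)
pose k := trunc_log (N * b) (n %/ d).
have nd0 : (0 < n %/ d)%N by rewrite divn_gt0.
have /andP[nk nSk] := trunc_log_bounds Nb_gt1 nd0.
have Wn : (#|` line_grid (d := d) A k| <= n)%N.
  apply: leq_trans (card_line_grid A k b0) _.
  by rewrite -NE mulnC -leq_divRL.
have [S [Smax SE]] := vertex_cut_half_ex (R := R) (line_grid_edge (d := d) (A := A) (k := k)).
have cutE := line_grid_cut d0 b0 q0 Smax; rewrite -NE in cutE.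
have We : finite_subgraph (sponge d A m) (line_grid_edge (d := d) (A := A) (k := k)).
  by rewrite m1; exact: line_grid_subgraph.
have sepS := sep_ge (R := R) We Wn; rewrite SE in sepS.
apply: (@le_trans _ _ ((d * (N * b) ^ k.+1)%N%:R `^ E)).
  rewrite ler_powR_growth_exponent ?ler_nat ?(ltnW b3)//.
  by rewrite mulnC ltnW// -ltn_divLR.
rewrite natrM powRM// powR_growth_exponent ?(ltnW b3)// [_ * d%:R `^ E]mulrC -mulrA.
rewrite ler_wpM2l ?powR_ge0//.
apply: (@le_trans _ _ ((4 * d ^ 2 * N) * #|S|)%N%:R); last by rewrite [leLHS]natrM ler_wpM2l.
by rewrite ler_nat expnS mulnAC mulnC leq_mul.
Qed.

End SpongeSeparation.

Theorem theorem2 (R : realType) (d b : nat) (A : {set 'I_b}) (m : nat)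
    (hd : (2 <= d)%N) (hb : (3 <= b)%N) (hm : (m <= d)%N)
    (hN : (1 <= Nsum d A m)%N) :
  let E : R := growth_exponent b (Nsum d A m) in
  preceq (fun n : nat => sep (2^-1 : R) (sponge d A m) n)
         (fun n : nat => n%:R `^ E)
  /\ (m = 1%N ->
      E = (d%:R - 1) * ln (b - #|A|)%N%:R
          / ((d%:R - 1) * ln (b - #|A|)%N%:R + ln b%:R)
      /\ asymp (fun n : nat => sep (2^-1 : R) (sponge d A m) n)
               (fun n : nat => n%:R `^ E)).
Proof.
move=> E.
have upper : preceq (fun n : nat => sep (2^-1 : R) (sponge d A m) n)
    (fun n : nat => n%:R `^ E).
  have [c c0 cP] := sep_sponge_le (R := R) hd hb hN.
  apply: (@preceq_le _ _ _ c%:R 1) => [|n n1|n]; first by rewrite ltr0n.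
    by rewrite sep_ge0 cP.
  exact: powR_ge0.
split=> // m1; split; last first.
  split=> //; have [c c0 cP] := sep_sponge1_ge (R := R) hd hb hN m1.
  have d0 : 0 < (d%:R : R) `^ E by rewrite powR_gt0// ltr0n ltnW.
  apply: (@preceq_le _ _ _ (c%:R * d%:R `^ E) d) => [|n dn|n].
  - by rewrite mulr_gt0 ?ltr0n.
  - by rewrite powR_ge0 cP.
  - exact: sep_ge0.
rewrite /E /growth_exponent {E upper}.
have NE : Nsum d A m = ((b - #|A|) ^ d.-1)%N.
  by rewrite m1 /Nsum big_ord1 bin0 !mul1n /= subn0 subn1.
have q0 : (0 < b - #|A|)%N.
  by rewrite NE expn_gt0 in hN; case/orP: hN => //; lia.
have -> : ln (Nsum d A m)%:R = (d%:R - 1) * ln (b - #|A|)%N%:R :> R.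
  by rewrite NE natrX lnXn ?ltr0n// -[LHS]mulr_natl -subn1 (natrB _ (ltnW hd)).
by [].
Qed.
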